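(* For constructible bimodules $M,N:\mathbb{R}^2\to\mathbf{vec}$, $$\mathrm{d_E}(\mathbf{mrk}_M,\mathbf{mrk}_N)\le \mathrm{d_I}(M,N),$$ where $\mathrm{d_E}$ is the erosion distance between meta-ranks and $\mathrm{d_I}$ is the interleaving distance.
   Context: Fix a field $\mathbf{k}$; $\mathbf{vec}$ is the category of finite-dimensional $\mathbf{k}$-vector spaces. A persistence module over a poset $P$ is a functor $M:P\to\mathbf{vec}$, with internal maps $\varphi_M(p\le q)$; a bimodule is a persistence module over $\mathbb{R}^2$ with the product order. Constructibility. Let $S=\{s_1<\dots<s_n\}\subset\mathbb{R}$ be finite, and set $s_{n+1}:=\infty$ for this definition. $M:\mathbb{R}\to\mathbf{vec}$ is $S$-constructible if $M(a)=0$ for $a<s_1$ and $\varphi_M(a\le b)$ is an isomorphism whenever $s_i\le a\le b<s_{i+1}$, $1\le i\le n$. A bimodule $M$ is $S$-constructible if $M((x,y))=0$ whenever $x<s_1$ or $y<s_1$, and $\varphi_M((x_1,y_1)\le(x_2,y_2))$ is an isomorphism whenever $s_i\le x_1\le x_2<s_{i+1}$ and $s_j\le y_1\le y_2<s_{j+1}$, $1\le i,j\le n$. A module is constructible if it is $S$-constructible for some finite nonempty $S$. All modules are assumed constructible. A constructible module over $\mathbb{R}$ is determined up to isomorphism by its barcode $\mathrm{barc}(M)$, the multiset of intervals $I$ (of the form $[b,d)$, $b\in\mathbb{R}$, $d\in\mathbb{R}\cup\{\infty\}$) with $M\cong\bigoplus_{I\in\mathrm{barc}(M)}\mathbf{k}^I$.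 $\mathbf{Pvec}$ denotes the set of isomorphism classes $[M]$ of such persistence modules over $\mathbb{R}$. $\mathrm{Dgm}$ is the poset, ordered by inclusion, of all intervals $[p,q)$ with $p<q$ in $\mathbb{R}$ and all $[p,\infty)$, $p\in\mathbb{R}$. For a bimodule $M$ and $s\in\mathbb{R}$, the vertical slice $M_x^s:\mathbb{R}\to\mathbf{vec}$ is $M_x^s(a)=M((s,a))$ with internal maps $\varphi_M((s,a)\le(s,b))$; for $s\le t$, $\phi_x(s\le t):M_x^s\to M_x^t$ is $\phi_x(s\le t)(a):=\varphi_M((s,a)\le(t,a))$. (Horizontal) meta-rank. For $S$-constructible $M$, $\mathbf{mrk}_M:\mathrm{Dgm}\to\mathbf{Pvec}$ is defined by: for $I=[s,s_i)$ with $s_i\in S$, $\mathbf{mrk}_M(I):=[\mathrm{im}(\phi_x(s\le s_i-\delta))]$ for some $\delta>0$ with $s_i-\delta\ge s$ and $s_i-\delta\ge s_{i-1}$ ($s_0$ being any value less than $s_1$); for $I=[s,\infty)$, $\mathbf{mrk}_M(I):=[\mathrm{im}(\phi_x(s\le\max(s,s_n)))]$; for all other $I=[s,t)$, $\mathbf{mrk}_M(I):=[\mathrm{im}(\phi_x(s\le t))]$. Erosion distance. For $\epsilon\ge0$ and $M:\mathbb{R}\to\mathbf{vec}$, $\mathrm{barc}_\epsilon(M)$ is the multiset obtained from $\mathrm{barc}(M)$ by replacing each $[s,t)$ with $[s+\epsilon,t)$ and discarding those with $t-s\le\epsilon$. For $M,N:\mathbb{R}\to\mathbf{vec}$, write $M\preceq_\epsilon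 N$ if there is an injection of multisets $\iota:\mathrm{barc}_\epsilon(M)\hookrightarrow\mathrm{barc}(N)$ with $J\subseteq\iota(J)$ for all $J\in\mathrm{barc}_\epsilon(M)$. The shift $M^\epsilon$ is $M^\epsilon(a):=M(a+\epsilon)$, $\varphi_{M^\epsilon}(a\le b):=\varphi_M(a+\epsilon\le b+\epsilon)$. For $I=[s,t)\in\mathrm{Dgm}$, $I^\epsilon_{-\epsilon}:=[s-\epsilon,t+\epsilon)$, with $\infty+\epsilon=\infty$. For bimodules $M,N$, $$\mathrm{d_E}(\mathbf{mrk}_M,\mathbf{mrk}_N):=\inf\{\epsilon>0:\ \forall I\in\mathrm{Dgm},\ \mathbf{mrk}_M(I^\epsilon_{-\epsilon})^\epsilon\preceq_{2\epsilon}\mathbf{mrk}_N(I)\text{ and }\mathbf{mrk}_N(I^\epsilon_{-\epsilon})^\epsilon\preceq_{2\epsilon}\mathbf{mrk}_M(I)\},$$ with value $\infty$ if the set is empty. Interleaving distance. For $\epsilon\ge0$ put $\bar\epsilon=(\epsilon,\epsilon)$ and $M^{\bar\epsilon}(p):=M(p+\bar\epsilon)$ with the evident internal maps. $M,N:\mathbb{R}^2\to\mathbf{vec}$ are $\epsilon$-interleaved if there are natural transformations $f:M\to N^{\bar\epsilon}$, $g:N\to M^{\bar\epsilon}$ with $g_{p+\bar\epsilon}\circ f_p=\varphi_M(p\le p+2\bar\epsilon)$ and $f_{p+\bar\epsilon}\circ g_p=\varphi_N(p\le p+2\bar\epsilon)$ for all $p$. $\mathrm{d_I}(M,N)$ is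 the infimum of $\epsilon\ge0$ such that $M,N$ are $\epsilon$-interleaved ($\infty$ if none). *)

(* Defs.v *)
From HB Require Import structures.
From mathcomp Require Import all_boot all_order all_algebra.
From mathcomp Require Import interval_inference boolp classical_sets reals ereal.

Set Implicit Arguments.
Unset Strict Implicit.
Unset Printing Implicit Defensive.

Import Order.TTheory GRing.Theory Num.Theory.

Local Open Scope classical_set_scope.
Local Open Scope ring_scope.

Record pmod (k : fieldType) (d : Order.disp_t) (P : porderType d) := PMod {
  obj :> P -> vectType k;
  mor : forall p q : P, (p <= q)%O -> 'Hom(obj p, obj q);
  mor_id : forall (p : P) (h : (p <= p)%O), mor h = \1%VF;
  mor_comp : forall (p q r : P) (pq : (p <= q)%O) (qr : (q <= r)%O)
    (pr : (p <= r)%O), mor pr = (mor qr \o mor pq)%VF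
}.
Arguments mor {k d P} M {p q} h : rename.
Arguments mor_id {k d P} M {p} h : rename.
Arguments mor_comp {k d P} M {p q r} pq qr pr : rename.

Record pmor (k : fieldType) (d : Order.disp_t) (P : porderType d)
    (M N : pmod k P) := PMor {
  comp_at :> forall p : P, 'Hom(M p, N p);
  pmor_nat : forall (p q : P) (pq : (p <= q)%O),
    (comp_at q \o mor M pq)%VF = (mor N pq \o comp_at p)%VF
}.

Definition pmod_iso (k : fieldType) (d : Order.disp_t) (P : porderType d)
    (M N : pmod k P) : Prop :=
  exists (f : pmor M N) (g : pmor N M),
    (forall p, cancel (f p) (g p)) /\ (forall p, cancel (g p) (f p)).

Section Constructions.
Variables (k : fieldType) (d : Order.disp_t) (P : porderType d).

Section Reindex.
Variables (d' : Order.disp_t) (Q : porderType d').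
Variables (h : Q -> P) (h_mono : {homo h : x y / (x <= y)%O}) (M : pmod k P).

(* The composite functor M o h, for h order-preserving. *)
Definition reindex : pmod k Q.
Proof.
exists (fun x => M (h x)) (fun x y xy => mor M (h_mono xy)).
- by move=> x xx; exact: mor_id.
- by move=> x y z xy yz xz; exact: mor_comp.
Defined.

End Reindex.

Section Image.
Variables (M N : pmod k P) (f : pmor M N).

Let V p := limg (f p).

Let im_mor p q (pq : (p <= q)%O) : 'Hom(subvs_of (V p), subvs_of (V q)) :=
  (linfun (vsproj (V q)) \o mor N pq \o linfun vsval)%VF.

Let vsval_im_mor p q (pq : (p <= q)%O) u :
  vsval (im_mor pq u) = mor N pq (vsval u).
Proof.
rewrite !comp_lfunE !lfunE /= vsprojK //.
have /memv_imgP[v _ ->] := subvsP u.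
rewrite -[mor N pq _]comp_lfunE -pmor_nat comp_lfunE /=.
exact/memv_img/memvf.
Qed.

Definition im : pmod k P.
Proof.
exists (fun p => Vector.clone k (subvs_of (V p)) _) im_mor.
- by move=> p pp; apply/lfunP => u; apply: val_inj;
    rewrite /= vsval_im_mor mor_id !id_lfunE.
- move=> p q r pq qr pr; apply/lfunP => u; apply: val_inj.
  by rewrite /= comp_lfunE !vsval_im_mor (mor_comp _ pq qr pr) comp_lfunE.
Defined.

End Image.

Definition pmod0 : pmod k P.
Proof.
exists (fun=> Vector.clone k 'rV[k]_0 _) (fun _ _ _ => \1%VF).
- by [].
- by move=> *; rewrite comp_lfun1l.
Defined.

Section DirectSum.

Definition pair_map (U U' W W' : vectType k) (f : 'Hom(U, W)) (g : 'Hom(U', W'))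
  (u : U * U') : W * W' := (f u.1, g u.2).

Let pair_map_linear (U U' W W' : vectType k) (f : 'Hom(U, W)) (g : 'Hom(U', W')) :
  linear (pair_map f g).
Proof. by move=> a u v; rewrite /pair_map /= !linearP. Qed.

HB.instance Definition _ (U U' W W' : vectType k) (f : 'Hom(U, W))
    (g : 'Hom(U', W')) :=
  GRing.isLinear.Build k (U * U')%type (W * W')%type _ (pair_map f g)
    (pair_map_linear f g).

Variables M N : pmod k P.

Definition dsum : pmod k P.
Proof.
exists (fun p => Vector.clone k (M p * N p)%type _)
  (fun p q pq => linfun (pair_map (mor M pq) (mor N pq))).
- by move=> p pp; apply/lfunP => -[u v]; rewrite lfunE id_lfunE /= /pair_map !mor_id !id_lfunE.
- move=> p q r pq qr pr; apply/lfunP => -[u v].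
  by rewrite comp_lfunE !lfunE /= /pair_map /= !(mor_comp _ pq qr pr) !comp_lfunE.
Defined.

End DirectSum.
End Constructions.

(* A pair (b, d) with b < d stands for the interval [b, d); d is finite or
   +oo, since -oo < b for all b. *)
Record dgm (R : realType) := Dgm {
  bounds : R * \bar R;
  _ : (bounds.1%:E < bounds.2)%E
}.
HB.instance Definition _ (R : realType) := [isSub for @bounds R].
HB.instance Definition _ (R : realType) := [Choice of dgm R by <:].

Section Barcodes.
Variables (k : fieldType) (R : realType).

Definition birth (I : dgm R) : R := (bounds I).1.
Definition death (I : dgm R) : \bar R := (bounds I).2.

Definition mem_dgm (I : dgm R) (x : R) : bool :=
  (birth I <= x) && (x%:E < death I)%E.
Definition set_of_dgm (I : dgm R) : set R := [set x | mem_dgm I x].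

(* k^I: 'rV_1 at the points of I and 'rV_0 elsewhere; the 1 x 1 matrix const_mx 1
   is the identity. *)
Definition interval_mod (I : dgm R) : pmod k R.
Proof.
exists (fun x => Vector.clone k 'rV[k]_(mem_dgm I x) _)
  (fun x y _ => linfun (mulmxr (const_mx 1 : 'M_(mem_dgm I x, mem_dgm I y)))).
- move=> x _; apply/lfunP => u; rewrite id_lfunE lfunE /=.
  rewrite (_ : const_mx 1 = 1%:M) ?mulmx1 //.
  by apply/matrixP; case: mem_dgm => i j; rewrite !mxE ?ord1 //; case: i.
- move=> x y z xy yz xz; apply/lfunP => u; rewrite comp_lfunE !lfunE /= -mulmxA.
  congr (_ *m _); apply/matrixP => i j; rewrite !mxE.
  have : mem_dgm I x -> mem_dgm I z -> mem_dgm I y.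
    rewrite /mem_dgm => /andP[bx _] /andP[_ zd].
    by rewrite (le_trans bx xy) (le_lt_trans _ zd) ?lee_fin.
  case: (mem_dgm I x) i => [i|[]//]; case: (mem_dgm I z) j => [j|[]//].
  by move=> /(_ isT isT) ->; rewrite big_ord1 !mxE mulr1.
Defined.

Definition sum_of_bars (B : seq (dgm R)) : pmod k R :=
  foldr (fun I N => dsum (interval_mod I) N) (pmod0 k R) B.

Definition is_barcode (M : pmod k R) (B : seq (dgm R)) : Prop :=
  pmod_iso M (sum_of_bars B).

(* Multisets are sequences up to permutation; barc M is a chosen enumeration of
   the barcode of M, with junk value [::] when M is not a finite sum of interval
   modules. *)
Definition barc (M : pmod k R) : seq (dgm R) :=
  xget [::] [set B | is_barcode M B].

(* insub returns None, and pmap drops the bar, exactly when d <= b + e. *)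
Definition barc_eps (e : R) (M : pmod k R) : seq (dgm R) :=
  pmap (fun I : dgm R => insub (birth I + e, death I)) (barc M).

Definition preceq (e : R) (M N : pmod k R) : Prop :=
  let A := barc_eps e M in let B := barc N in
  exists2 i : 'I_(size A) -> 'I_(size B), injective i &
    forall j, set_of_dgm (tnth (in_tuple A) j)
                `<=` set_of_dgm (tnth (in_tuple B) (i j)).

Lemma pmod_iso_sym (M N : pmod k R) : pmod_iso M N -> pmod_iso N M.
Proof. by move=> [f [g [fg gf]]]; exists g, f. Qed.

Lemma pmod_iso_trans (L M N : pmod k R) :
  pmod_iso L M -> pmod_iso M N -> pmod_iso L N.
Proof.
move=> [f [g [fK gK]]] [f' [g' [f'K g'K]]].
have fP p q (pq : (p <= q)%O) :
    ((f' q \o f q) \o mor L pq)%VF = (mor N pq \o (f' p \o f p))%VF.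
  by rewrite -comp_lfunA pmor_nat comp_lfunA pmor_nat -comp_lfunA.
have gP p q (pq : (p <= q)%O) :
    ((g q \o g' q) \o mor N pq)%VF = (mor L pq \o (g p \o g' p))%VF.
  by rewrite -comp_lfunA pmor_nat comp_lfunA pmor_nat -comp_lfunA.
exists (PMor fP), (PMor gP); split=> p u; rewrite /= !comp_lfunE /=.
- by rewrite f'K fK.
- by rewrite gK g'K.
Qed.

(* barc is a function on isomorphism classes. *)
Lemma barc_iso (M N : pmod k R) : pmod_iso M N -> barc M = barc N.
Proof.
move=> MN; congr (xget _ _); apply/seteqP; split=> B /=.
- exact/pmod_iso_trans/pmod_iso_sym.
- exact: pmod_iso_trans.
Qed.

Lemma addr_homo (e : R) : {homo (fun a : R => a + e) : a b / a <= b}.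
Proof. by move=> a b ab; rewrite lerD2r. Qed.

Definition shift (e : R) (M : pmod k R) : pmod k R := reindex (addr_homo e) M.

End Barcodes.

(* *p is the product order. *)
Notation bimod k R := (pmod k (R *p R)%type).

Section Bimodules.
Variables (k : fieldType) (R : realType).
Implicit Types (M N : bimod k R) (S : seq R).

(* Indices start from 0; the value at i = size S is +oo. *)
Definition knot S (i : nat) : \bar R := nth +oo%E [seq s%:E | s <- S] i.

Definition in_cell S (i : nat) (x : R) : bool :=
  (knot S i <= x%:E < knot S i.+1)%E.

(* S is the increasing enumeration of a finite nonempty set. *)
Definition constructible S M : Prop :=
  [/\ sorted <%R S, S != [::],
      (forall p : (R *p R)%type, p.1 < head 0 S \/ p.2 < head 0 S ->
         \dim {:M p} = 0%N) &
      forall (i j : nat) (p q : (R *p R)%type) (pq : (p <= q)%O),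
        (i < size S)%N -> (j < size S)%N ->
        in_cell S i p.1 -> in_cell S i q.1 ->
        in_cell S j p.2 -> in_cell S j q.2 -> bijective (mor M pq)].

Lemma vline_homo (s : R) :
  {homo (fun a : R => (s, a) : (R *p R)%type) : a b / (a <= b)%O}.
Proof. by move=> a b ab; rewrite Order.ProdOrder.leEprod /= lexx. Qed.

Definition slice M (s : R) : pmod k R := reindex (vline_homo s) M.

Lemma hline_homo (a : R) :
  {homo (fun s : R => (s, a) : (R *p R)%type) : s t / (s <= t)%O}.
Proof. by move=> s t st; rewrite Order.ProdOrder.leEprod /= lexx st. Qed.

Definition phi_x M (s t : R) (st : s <= t) : pmor (slice M s) (slice M t).
Proof.
exists (fun a => mor M (hline_homo a st)) => a b ab.
by have h := le_trans (hline_homo a st) (vline_homo t ab); rewrite -!(mor_comp _ _ _ h).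
Defined.

(* mrk M I is the class of the image of phi_x from birth I to mrk_end S I.
   For t = s_i the point s_i - delta used is max(birth I, s_{i-1}), where
   s_0 := birth I. *)
Definition mrk_end S (I : dgm R) : R :=
  let s := birth I in
  match death I with
  | t%:E => if t \in S then Num.max s (nth s (s :: S) (index t S)) else t
  | _ => Num.max s (last s S)
  end.

Lemma mrk_end_ge S (I : dgm R) : birth I <= mrk_end S I.
Proof.
rewrite /mrk_end; case: I => -[s [t| |]] //= st; rewrite /birth /death /=.
- by case: ifP; rewrite ?le_max ?lexx // -lee_fin ltW.
- by rewrite le_max lexx.
Qed.

(* Isomorphism classes are given by representatives; see barc_iso. *)
Definition mrk S M (I : dgm R) : pmod k R := im (phi_x M (mrk_end_ge S I)).

Lemma expand_proof (e : {posnum R}) (I : dgm R) :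
  ((birth I - e%:num)%:E < death I + e%:num%:E)%E.
Proof.
case: I => -[s [t| |]] //=; rewrite /birth /death /= ?ltry // !lte_fin => st.
by rewrite ltrBlDr -addrA ltr_wpDr // addr_ge0.
Qed.

Definition expand (e : {posnum R}) (I : dgm R) : dgm R :=
  @Dgm R (birth I - e%:num, (death I + e%:num%:E)%E) (expand_proof e I).

Definition erosion_le (e : {posnum R}) (F G : dgm R -> pmod k R) : Prop :=
  forall I : dgm R,
    preceq (2 * e%:num) (shift e%:num (F (expand e I))) (G I).

Definition d_E (F G : dgm R -> pmod k R) : \bar R :=
  ereal_inf [set e%:num%:E | e in
    [set e : {posnum R} | erosion_le e F G /\ erosion_le e G F]].

Definition dshift (e : R) (p : (R *p R)%type) : (R *p R)%type :=
  (p.1 + e, p.2 + e).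

Lemma dshift_homo (e : R) : {homo dshift e : p q / (p <= q)%O}.
Proof. by move=> p q; rewrite !Order.ProdOrder.leEprod /= !lerD2r. Qed.

Definition shift2 (e : R) M : bimod k R := reindex (dshift_homo e) M.

Lemma dshift2_le (e : {nonneg R}) (p : (R *p R)%type) :
  (p <= dshift e%:num (dshift e%:num p))%O.
Proof.
by rewrite Order.ProdOrder.leEprod /= -!addrA !lerDl !addr_ge0.
Qed.

Definition interleaved (e : {nonneg R}) M N : Prop :=
  exists (f : pmor M (shift2 e%:num N)) (g : pmor N (shift2 e%:num M)),
    (forall p, (g (dshift e%:num p) \o f p)%VF = mor M (dshift2_le e p)) /\
    (forall p, (f (dshift e%:num p) \o g p)%VF = mor N (dshift2_le e p)).

Definition d_I M N : \bar R :=
  ereal_inf [set e%:num%:E | e in [set e : {nonneg R} | interleaved e M N]].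

End Bimodules.

(* Main.v *)
From HB Require Import structures.
Require Import Defs.
From mathcomp Require Import all_boot all_order fingroup perm all_algebra.
From mathcomp Require Import interval_inference boolp classical_sets reals ereal.

Set Implicit Arguments.
Unset Strict Implicit.
Unset Printing Implicit Defensive.

Import Order.TTheory GRing.Theory Num.Theory.

Local Open Scope ring_scope.

(** The statement reduces to a single claim: if M and N are e-interleaved and
eps >= e is positive, then the two meta-ranks erode into each other at scale
eps.  The infimum over eps then gives the inequality of distances.

Fix I = [s, t).  Constructibility makes the meta-rank of N at I isomorphic to
Y(a) = im(N(s,a) -> N(w,a)) for every w < t close enough to t, and the meta-rank
of M at the expanded interval isomorphic to im(M(s-eps,_) -> M(w+eps,_)) for the
same w (mrk_iso_near); this removes the case distinction in the definition of
the meta-rank.  Let X(a) = im(M(s-eps,a+eps) -> M(w+eps,a+eps)) be the shift of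
the latter.  The chain
  M(s-eps,a+eps) -> N(s,a+2eps) -> N(w,a+2eps) -> M(w+eps,a+3eps)
composes to an internal map of M.  Hence, inside Z(a) = M(w+eps,a+eps), the
image of X(a) -> X(a+2eps) is contained in the image of Y(a+2eps): it is a
subquotient of Y.

Two facts about modules over the line finish the proof.

- Existence of barcodes (barcode_exists).  A module that vanishes near -oo and
  is constant between finitely many knots is a sum of interval modules.  Take
  the first knot b at which it is not zero, a nonzero vector x at b, and the
  interval [b, d) on which x survives.  A linear form that is 1 on x just before
  d, pulled back along the transition maps, is a natural retraction onto the
  interval module spanned by x, so this module splits off; induct on the total
  dimension at the knots.  Without this fact the sequence barc could be the
  junk value.

- Matching (bar_matching).  Write each vector of X that starts a bar [p, q),
  pushed to p+2eps, as the image of a combination of bars of Y, and keep only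
  the coefficients of bars of Y that contain [p+2eps, q).  The resulting matrix
  has independent rows: given a relation, look at a row in its support with the
  largest q, at a point just below q, where the dropped coefficients concern
  bars that are already dead.  So some maximal minor is nonzero and a nonzero
  term of its Leibniz expansion is an injection of bars (row_free_matching). *)

(** * Transition maps and knots *)

Section Transition.
Variables (k : fieldType) (disp : Order.disp_t) (P : porderType disp).
Implicit Types (M N : pmod k P).

(** Extending the internal maps by 0 to all pairs of points removes the
comparison proofs from the terms, so that equal points given by different
formulas need no transport. *)
Definition transition M (p q : P) : 'Hom(M p, M q) :=
  if decP (@idP (p <= q)%O) is left h then mor M h else 0.

Lemma transitionE M (p q : P) (h : (p <= q)%O) : transition M p q = mor M h.
Proof.
by rewrite /transition; case: decP => // h'; rewrite (bool_irrelevance h h').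
Qed.

Lemma transition_id M (p : P) v : transition M p p v = v.
Proof. by rewrite (transitionE _ (lexx p)) mor_id id_lfunE. Qed.

Lemma transition_comp M (p q r : P) v : (p <= q)%O -> (q <= r)%O ->
  transition M q r (transition M p q v) = transition M p r v.
Proof.
move=> pq qr; have pr := le_trans pq qr.
by rewrite !transitionE (mor_comp M pq qr pr) comp_lfunE.
Qed.

Lemma transition_nat M N (f : pmor M N) (p q : P) v : (p <= q)%O ->
  f q (transition M p q v) = transition N p q (f p v).
Proof. by move=> pq; rewrite !transitionE -!comp_lfunE pmor_nat. Qed.

Lemma iso_of_bijective M N (f : pmor M N) :
  (forall p, injective (f p)) -> (forall p v, exists u, f p u = v) ->
  pmod_iso M N.
Proof.
move=> finj fsurj.
have k0 p : lker (f p) == 0%VS by apply/lker0P.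
have fVK p : cancel (f p)^-1%VF (f p).
  by move=> v; have [u <-] := fsurj p v; rewrite lker0_lfunK.
have nat p q (pq : (p <= q)%O) :
    ((f q)^-1 \o mor N pq)%VF = (mor M pq \o (f p)^-1)%VF.
  apply/lfunP => v; apply: (finj q); rewrite !comp_lfunE fVK.
  by rewrite -[f q (mor M pq _)]comp_lfunE pmor_nat comp_lfunE fVK.
exists f, (PMor nat); split=> p u /=; first exact: lker0_lfunK.
exact: fVK.
Qed.

End Transition.

Section Extremum.
Variables (R : realType).

Lemma seq_max (S : seq R) (P : pred R) :
  {in S, forall r, ~~ P r} \/
  exists r, [/\ r \in S, P r & {in S, forall r', P r' -> r' <= r}].
Proof.
elim: S => [|r S [no|[m [mS Pm mmax]]]]; first by left.
- have [Pr|nPr] := boolP (P r); [right|left].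
    exists r; split=> //; first exact: mem_head.
    by move=> r'; rewrite inE => /predU1P[->//|/no/negP].
  by move=> r'; rewrite inE => /predU1P[->//|/no].
right; have [/andP[Pr mr]|/nandP Pmr] := boolP (P r && (m <= r)).
  exists r; split=> //; first exact: mem_head.
  move=> r'; rewrite inE => /predU1P[->//|r'S Pr'].
  exact: le_trans (mmax _ r'S Pr') mr.
exists m; split=> //; first by rewrite inE mS orbT.
move=> r'; rewrite inE => /predU1P[->|r'S] Pr'; last exact: mmax.
by case: Pmr => [/negP//|]; rewrite -ltNge => /ltW.
Qed.

Lemma seq_min (S : seq R) (P : pred R) :
  {in S, forall r, ~~ P r} \/
  exists r, [/\ r \in S, P r & {in S, forall r', P r' -> r <= r'}].
Proof.
have [no|[m [mS Pm mmax]]] := seq_max [seq - r | r <- S] (fun r => P (- r)).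
  left=> r rS; have := no (- r); rewrite opprK; apply; exact: map_f.
right; exists (- m); split=> //.
  by case/mapP: mS => r rS ->; rewrite opprK.
by move=> r rS Pr; rewrite lerNl; apply: mmax; rewrite ?opprK ?map_f.
Qed.

End Extremum.

Definition knot_free (R : realType) (S : seq R) (x y : R) :=
  forall r, r \in S -> x < r -> y < r.

Lemma last_knot (R : realType) (S : seq R) (x : R) :
  {in S, forall r, x < r} \/ exists r, [/\ r \in S, r <= x & knot_free S r x].
Proof.
have [no|[r [rS rx rmax]]] := seq_max S (fun r => r <= x); [left|right].
  by move=> r /no; rewrite -ltNge.
exists r; split=> // r' r'S rr'; rewrite ltNge; apply/negP => /(rmax _ r'S).
by rewrite leNgt rr'.
Qed.

(** Constructibility over the line, phrased with knots instead of cells so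
that the knots need not be sorted. *)
Definition tame (k : fieldType) (R : realType) (S : seq R) (X : pmod k R) :=
  (forall x, {in S, forall r, x < r} -> forall v : X x, v = 0) /\
  (forall x y, x <= y -> knot_free S x y -> bijective (transition X x y)).

(** * Existence of barcodes

Submodules are handled as families of subspaces of one fixed module, so that
the induction never changes the ambient module. *)

Section SplitBar.
Variables (k : fieldType) (R : realType) (S : seq R) (X : pmod k R).
Hypothesis tameX : tame S X.
Notation tr := (transition X).

Lemma tame_inj x y : x <= y -> knot_free S x y -> injective (tr x y).
Proof. by move=> xy /(tameX.2 _ _ xy) /bij_inj. Qed.

(** The second condition says that the subspaces, too, are carried onto each
other between knots. *)
Definition tame_sub (U : forall x, {vspace X x}) :=
  (forall x y v, x <= y -> v \in U x -> tr x y v \in U y) /\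
  (forall x y v, x <= y -> knot_free S x y -> tr x y v \in U y -> v \in U x).

Lemma tame_sub_surj U x y v : tame_sub U -> x <= y -> knot_free S x y ->
  v \in U y -> exists2 u, u \in U x & tr x y u = v.
Proof.
move=> [_ tU] xy fxy vU; have [h _ hK] := tameX.2 _ _ xy fxy.
by exists (h v); rewrite ?hK //; apply: tU xy fxy _; rewrite hK.
Qed.

Lemma tame_sub_zero U x : tame_sub U ->
  (forall r, r \in S -> r <= x -> U r = 0%VS) -> U x = 0%VS.
Proof.
move=> tU U0; apply/eqP; rewrite -subv0; apply/subvP => v vU.
have [before|[r [rS rx frx]]] := last_knot S x.
  by rewrite (tameX.1 _ before v) mem0v.
have [u uU <-] := tame_sub_surj tU rx frx vU.
by move: uU; rewrite U0 // memv0 => /eqP ->; rewrite linear0 mem0v.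
Qed.

(** The vector [x0], born at [b], survives exactly until [d]; [l] will be
the last knot before [d]. *)
Section Bar.
Variables (b : R) (x0 : X b) (d : \bar R) (l : R).
Hypothesis bl : b <= l.
Hypothesis ld : (l%:E < d)%E.
Hypothesis alive : forall x, b <= x -> (tr b x x0 == 0) = (d <= x%:E)%E.
Hypothesis lastl : forall x, l <= x -> (x%:E < d)%E -> knot_free S l x.

Definition bar_elt x : X x := if (x%:E < d)%E then tr b x x0 else 0.

(** Before [d] every space is compared with the one at [l]; past [l] the
transition from [l] is invertible. *)
Definition retract x : 'Hom(X x, X l) :=
  if x <= l then tr x l else (tr l x)^-1%VF.

Lemma retract_nat x y v : x <= y -> (y%:E < d)%E ->
  retract y (tr x y v) = retract x v.
Proof.
move=> xy yd; rewrite /retract.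
have K z w : l <= z -> (z%:E < d)%E -> (tr l z)^-1%VF (tr l z w) = w.
  by move=> lz zd; apply: lker0_lfunK; apply/lker0P/tame_inj => //; exact: lastl.
have [yl|/ltW ly] := leP y l.
  by rewrite (le_trans xy yl) transition_comp.
have [xl|lx] := leP x l; first by rewrite -(transition_comp v xl ly) K.
have xd : (x%:E < d)%E by apply: le_lt_trans yd; rewrite lee_fin.
have [h _ hK] := tameX.2 _ _ (ltW lx) (lastl (ltW lx) xd).
by rewrite -(hK v) transition_comp ?K // ltW.
Qed.

(** The kernel of a linear form that does not vanish on the image of [x0]. *)
Definition hyper := (<[tr b l x0]>^C)%VS.

Lemma x0l_neq0 : tr b l x0 != 0.
Proof. by rewrite alive // -ltNge. Qed.

Lemma hyperN (c : k) : c *: tr b l x0 \in hyper -> c = 0.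
Proof.
move=> cH; have : c *: tr b l x0 \in (<[tr b l x0]> :&: hyper)%VS.
  by rewrite memv_cap cH memvZ // memv_line.
rewrite capv_compl memv0 scaler_eq0 (negPf x0l_neq0) orbF; exact/eqP.
Qed.

Lemma hyper_dec v : exists c, v - c *: tr b l x0 \in hyper.
Proof.
have : v \in (<[tr b l x0]> + hyper)%VS by rewrite addv_complf memvf.
case/memv_addP => w /vlineP[c ->] [h hH ->]; exists c.
by rewrite addrC addKr.
Qed.

Variable U : forall x, {vspace X x}.
Hypothesis tU : tame_sub U.
Hypothesis x0U : x0 \in U b.
Hypothesis U0 : forall x, x < b -> U x = 0%VS.

(** A complement in [U] of the line spanned by the bar of [x0]: before [d] the
pullback of a hyperplane at [l], and from [d] on everything.  Before [b] the bar
is zero and so is [U], which is why [b] has to be the first point of [U]. *)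
Definition bar_compl x : {vspace X x} :=
  if (x%:E < d)%E then (U x :&: retract x @^-1: hyper)%VS else U x.

Lemma bar_complS x : (bar_compl x <= U x)%VS.
Proof. by rewrite /bar_compl; case: ifP => // _; exact: capvSl. Qed.

Lemma mem_bar_compl x v :
  (v \in bar_compl x) = (v \in U x) && ((x%:E < d)%E ==> (retract x v \in hyper)).
Proof.
by rewrite /bar_compl; case: ifP => _; rewrite ?andbT // memv_cap memv_preim.
Qed.

(** The pullback is compatible with all transitions before [d]; since [d] is a
knot or +oo, a knot-free step never crosses it. *)
Lemma bar_compl_tame :
  (forall x y, x <= y -> knot_free S x y -> (x%:E < d)%E -> (y%:E < d)%E) ->
  tame_sub bar_compl.
Proof.
move=> dknot; split=> x y v xy.
  rewrite !mem_bar_compl => /andP[vU /implyP vH]; rewrite tU.1 //=.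
  apply/implyP => yd; rewrite retract_nat //; apply: vH.
  by apply: le_lt_trans yd; rewrite lee_fin.
move=> fxy; rewrite !mem_bar_compl => /andP[vU /implyP vH].
rewrite (tU.2 _ _ _ xy fxy vU) /=; apply/implyP => xd.
have yd := dknot _ _ xy fxy xd.
by rewrite -(retract_nat v xy yd) vH.
Qed.

Lemma retract_elt x : b <= x -> (x%:E < d)%E -> retract x (tr b x x0) = tr b l x0.
Proof.
by move=> bx xd; rewrite retract_nat // /retract bl.
Qed.

Lemma bar_compl_direct x (c : k) : b <= x -> (x%:E < d)%E ->
  c *: bar_elt x \in bar_compl x -> c = 0.
Proof.
move=> bx xd; rewrite mem_bar_compl xd => /andP[_ /=].
by rewrite /bar_elt xd linearZ /= retract_elt // => /hyperN.
Qed.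

Lemma bar_compl_dec x v : v \in U x ->
  exists c, [/\ v - c *: bar_elt x \in bar_compl x &
    (b <= x) && (x%:E < d)%E || (c == 0)].
Proof.
move=> vU; have [/U0 Ux0|bx] := ltP x b.
  exists 0; rewrite scale0r subr0; split; last by rewrite eqxx orbT.
  by move: vU; rewrite Ux0 memv0 => /eqP ->; rewrite mem0v.
have [dx|xd] := leP d (x%:E)%E.
  exists 0; rewrite scale0r subr0 eqxx orbT; split=> //.
  by rewrite mem_bar_compl vU ltNge dx.
have [c cH] := hyper_dec (retract x v); exists c; split=> //.
rewrite mem_bar_compl xd /bar_elt xd rpredB ?memvZ ?tU.1 //=.
by rewrite linearB linearZ /= retract_elt.
Qed.

End Bar.
End SplitBar.

(** The space of an interval module at a point is the space of rows of length 0
or 1; summing the entries identifies it with 0 or with the field. *)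
Section AddBar.
Variables (k : fieldType) (R : realType).

Definition row_sum (m : nat) (u : 'rV[k]_m) : k := \sum_i u 0 i.

Lemma row_sum_const (m m' : bool) (u : 'rV[k]_m) :
  row_sum (u *m (const_mx 1 : 'M_(m, m'))) = if m' then row_sum u else 0.
Proof.
rewrite /row_sum; case: m' => /=; last by rewrite big_ord0.
by rewrite big_ord1 mxE; apply: eq_bigr => i _; rewrite mxE mulr1.
Qed.

Lemma row_sum_eq0 (m : bool) (u : 'rV[k]_m) : row_sum u = 0 -> u = 0.
Proof.
case: m u => u; last by rewrite [u]thinmx0.
by rewrite /row_sum big_ord1 => u0; apply/rowP => i; rewrite ord1 mxE.
Qed.

Lemma row_sum_true (m : bool) (c : k) : m ->
  row_sum (const_mx c : 'rV[k]_m) = c.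
Proof. by case: m => // _; rewrite /row_sum big_ord1 mxE. Qed.

Lemma row_sum_false (m : bool) (u : 'rV[k]_m) : ~~ m -> row_sum u = 0.
Proof. by case: m u => // u _; rewrite /row_sum big_ord0. Qed.

Section Fun.
Variables (m : nat) (V W : vectType k) (e : W) (h : 'Hom(V, W)).

Definition add_vec (u : 'rV[k]_m * V) : W := row_sum u.1 *: e + h u.2.

Fact add_vec_linear : linear add_vec.
Proof.
move=> a u v; rewrite /add_vec /= linearP scalerDr scalerA addrACA -scalerDl.
congr (_ *: _ + _); rewrite /row_sum big_distrr -big_split /=.
by apply: eq_bigr => i _; rewrite !mxE.
Qed.

HB.instance Definition _ :=
  GRing.isLinear.Build k ('rV[k]_m * V)%type W _ add_vec add_vec_linear.
End Fun.

Variables (X N : pmod k R) (I : dgm R) (e : forall x, X x) (g : pmor N X).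
Hypothesis e_tr : forall x y, x <= y -> mem_dgm I x ->
  transition X x y (e x) = if mem_dgm I y then e y else 0.

Definition add_bar : pmor (dsum (interval_mod k I) N) X.
Proof.
exists (fun x => linfun (@add_vec (mem_dgm I x) (N x) (X x) (e x) (g x))).
move=> x y xy; apply/lfunP => -[u v]; rewrite !comp_lfunE !lfunE /=.
rewrite /add_vec /= lfunE /= row_sum_const -transitionE linearD linearZ /=.
rewrite transitionE -[mor X xy (g x v)]comp_lfunE -pmor_nat comp_lfunE.
congr (_ + _); rewrite -transitionE.
have [mx|mx] := orP (orbN (mem_dgm I x)).
  by rewrite e_tr //; case: ifP; rewrite ?scaler0 ?scale0r.
by rewrite row_sum_false // if_same !scale0r.
Defined.

Lemma add_barE x u v : add_bar x (u, v) = row_sum u *: e x + g x v.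
Proof. by rewrite lfunE. Qed.

End AddBar.

Section BarcodeExistence.
Variables (k : fieldType) (R : realType) (S : seq R) (X : pmod k R).
Hypothesis tameX : tame S X.
Notation tr := (transition X).

(** Induction on the total dimension at the knots: an inclusion for the
complement of one bar extends to the sum with that bar. *)
Lemma barcode_of_sub n (U : forall x, {vspace X x}) : tame_sub S U ->
  (\sum_(r <- S) \dim (U r) < n)%N ->
  exists B (g : pmor (sum_of_bars k B) X),
    (forall x, injective (g x)) /\ (forall x, limg (g x) = U x).
Proof.
elim: n U => // n IH U tU; rewrite ltnS => Un.
have [U0|[b [bS Ub bmin]]] := seq_min S (fun r => U r != 0%VS).
  have nat0 (x y : R) (xy : (x <= y)%O) :
      ((0 : 'Hom(pmod0 k R y, X y)) \o mor (pmod0 k R) xy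
       = mor X xy \o (0 : 'Hom(pmod0 k R x, X x)))%VF.
    by rewrite comp_lfun0l comp_lfun0r.
  exists [::], (PMor nat0).
  split=> x; first by move=> u v _; rewrite [u]thinmx0 [v]thinmx0.
  rewrite /= lim0g; apply/esym/(tame_sub_zero tameX tU) => r rS _.
  by apply/eqP; have := U0 r rS; rewrite negbK.
have U0 x : x < b -> U x = 0%VS.
  move=> xb; apply: (tame_sub_zero tameX tU) => r rS rx; apply/eqP/negPn/negP.
  by move=> /(bmin _ rS); rewrite leNgt (le_lt_trans rx xb).
pose x0 := vpick (U b).
have x0U : x0 \in U b by exact: memv_pick.
have x0n : x0 != 0 by rewrite vpick0.
(* The death of x0 is the first knot at which its image is zero, +oo if none. *)
have [d [bd dS alive]] : exists d : \bar R, [/\ (b%:E < d)%E,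
    forall r, d = r%:E -> r \in S
    & forall x, b <= x -> (tr b x x0 == 0) = (d <= x%:E)%E].
  have dead r x : b <= r -> r <= x -> tr b r x0 == 0 -> tr b x x0 == 0.
    by move=> br rx /eqP r0; rewrite -(transition_comp _ br rx) r0 linear0.
  have deadS x : b <= x -> tr b x x0 == 0 ->
      exists r, [/\ r \in S, b <= r, r <= x & tr b r x0 == 0].
    move=> bx x00; have [/(_ b bS)|[r [rS rx frx]]] := last_knot S x.
      by rewrite ltNge bx.
    have br : b <= r by rewrite leNgt; apply/negP => /(frx _ bS); rewrite ltNge bx.
    exists r; split=> //; move: x00; rewrite -(transition_comp _ br rx).
    by rewrite -(linear0 (tr r x)) (inj_eq (tame_inj tameX rx frx)).
  have [no|[d [dS /andP[bd d0] dmin]]] :=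
      seq_min S (fun r => (b <= r) && (tr b r x0 == 0)).
    exists +oo%E; split=> [||x bx]; rewrite ?ltry //.
    rewrite leye_eq /=; apply/negP => /(deadS x bx)[r [rS br _ r0]].
    by have := no r rS; rewrite br r0.
  exists d%:E; split=> [|r [<-]|x bx] //.
    rewrite lte_fin lt_neqAle bd andbT; apply: contraNneq x0n => db.
    by move: d0; rewrite -db transition_id.
  rewrite lee_fin; apply/idP/idP => [/(deadS x bx)[r [rS br rx r0]]|dx].
    by apply: le_trans rx; apply: dmin; rewrite ?br.
  exact: dead d0.
have [/(_ b bS)/negP//|[l [lS ld lmax]]] := seq_max S (fun r => (r%:E < d)%E).
have bl : b <= l by exact: lmax.
have lastl x : l <= x -> (x%:E < d)%E -> knot_free S l x.
  move=> lx xd r rS lr; rewrite ltNge; apply/negP => rx.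
  have rd : (r%:E < d)%E by apply: le_lt_trans xd; rewrite lee_fin.
  by move: lr; rewrite ltNge lmax.
have dknot x y : x <= y -> knot_free S x y -> (x%:E < d)%E -> (y%:E < d)%E.
  move=> xy fxy; case: d dS {bd alive ld lmax lastl} => [d| |] //= dS.
    by rewrite !lte_fin; apply: fxy; apply: dS.
  by rewrite !ltry.
pose I := @Dgm R (b, d) bd.
pose U' := bar_compl x0 d l U.
have tU' : tame_sub S U' by exact: (bar_compl_tame tameX).
have memI x : mem_dgm I x = (b <= x) && (x%:E < d)%E by [].
(* The total dimension drops because x0 itself leaves the submodule at b. *)
have lt_dim : (\sum_(r <- S) \dim (U' r) < \sum_(r <- S) \dim (U r))%N.
  rewrite (big_rem b bS) [ltnRHS](big_rem b bS) /= -addSn leq_add //; last first.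
    by apply: leq_sum => r _; apply/dimvS/bar_complS.
  rewrite ltn_neqAle dimvS ?bar_complS // andbT.
  apply: contraL x0U => eqU; have : U' b == U b.
    by rewrite eqEdim bar_complS (eqP eqU) leqnn.
  move=> /eqP <-; apply/negP => x0U'.
  have := @bar_compl_direct _ _ _ _ tameX b x0 d l bl ld alive lastl U b 1.
  rewrite scale1r /bar_elt bd transition_id => /(_ (lexx b) isT x0U')/eqP.
  by rewrite oner_eq0.
have [B [g [ginj gU]]] := IH U' tU' (leq_trans lt_dim Un).
pose e x := bar_elt x0 d x.
have e_tr x y : x <= y -> mem_dgm I x ->
    tr x y (e x) = if mem_dgm I y then e y else 0.
  move=> xy; rewrite !memI => /andP[bx xd].
  rewrite /e /bar_elt xd transition_comp // (le_trans bx xy) /=.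
  case: (boolP (y%:E < d)%E) => // yd; apply/eqP.
  by rewrite alive ?(le_trans bx) // leNgt.
exists (I :: B), (add_bar g e_tr); split=> x.
  apply/lker0P; rewrite -subv0; apply/subvP => -[u v].
  rewrite memv_ker add_barE memv0 => /eqP uv0.
  have gvU : g x v \in U' x by rewrite -gU memv_img ?memvf.
  have u0 : u = 0.
    apply: row_sum_eq0; have [mx|mx] := orP (orbN (mem_dgm I x)); last first.
      exact: row_sum_false.
    have /andP[bx xd] : (b <= x) && (x%:E < d)%E := mx.
    apply: (bar_compl_direct tameX bl ld alive lastl (U := U) bx xd).
    by move: gvU; rewrite -(addr0_eq uv0) memvN.
  move: uv0; rewrite u0 /row_sum big1 ?scale0r ?add0r; last first.
    by move=> i _; rewrite mxE.
  by move=> /eqP; rewrite -(linear0 (g x)) (inj_eq (ginj x)) => /eqP ->.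
apply/eqP; rewrite eqEsubv; apply/andP; split; apply/subvP => v.
  case/memv_imgP => -[u w] _ ->; rewrite add_barE rpredD //.
    rewrite rpredZ // /e /bar_elt; case: ifP => _; last exact: mem0v.
    have [xb|bx] := ltP x b; last exact: tU.1.
    rewrite /transition; case: decP => [h|_]; last by rewrite lfunE mem0v.
    by have := le_lt_trans h xb; rewrite ltxx.
  by apply: (subvP (bar_complS x0 d l U x)); rewrite -/U' -gU memv_img ?memvf.
move=> vU; have [c [cU' /orP h]] :=
  bar_compl_dec tameX bl lastl tU x0U U0 vU.
move: cU'; rewrite -/U' -gU => /memv_imgP[w _ vw].
apply/memv_imgP; exists (const_mx c : 'rV_(mem_dgm I x), w); first exact: memvf.
rewrite add_barE -vw; case: h => [mx|/eqP ->].
  by rewrite row_sum_true // addrC subrK.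
rewrite /row_sum big1 ?scale0r ?subr0 ?add0r // => i _.
by rewrite mxE.
Qed.

Lemma barcode_exists : exists B, is_barcode X B.
Proof.
have tU : tame_sub S (fun x => fullv : {vspace X x}).
  by split=> *; exact: memvf.
have [B [g [ginj gU]]] := barcode_of_sub tU (ltnSn _).
exists B; apply: pmod_iso_sym; apply: (iso_of_bijective ginj) => x v.
have : v \in limg (g x) by rewrite gU memvf.
by case/memv_imgP => u _ ->; exists u.
Qed.

(** For tame modules [barc] is not its junk value. *)
Lemma barc_is_barcode : is_barcode X (barc X).
Proof. by exact: (xgetPex [::] barcode_exists). Qed.

End BarcodeExistence.

(** * Bases adapted to a barcode, and matchings *)

(** A nonzero term in the Leibniz expansion of a nonzero maximal minor is an
injective choice of nonzero entries. *)
Lemma row_free_matching (k : fieldType) n m (A : 'M[k]_(n, m)) : row_free A ->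
  exists2 f : 'I_n -> 'I_m, injective f & forall i, A i (f i) != 0.
Proof.
move=> freeA; have fullA : row_full A^T by rewrite /row_full mxrank_tr.
pose f := fullrankfun fullA; pose D := rowsub f A^T.
have : \det D != 0.
  rewrite -unitfE -unitmxE -row_full_unit; exact: fullrowsub_full.
have [/existsP[s sD] _|/existsPn D0 /negP[]] :=
    boolP [exists s : 'S_n, \prod_i D i (s i) != 0]; last first.
  apply/eqP/big1 => s _; have := D0 s; rewrite negbK => /eqP ->.
  by rewrite mulr0.
exists (fun i => f ((s^-1)%g i)).
  by move=> i j /fullrankfun_inj /perm_inj.
move=> i; move/prodf_neq0: sD => /(_ ((s^-1)%g i) isT).
by rewrite permKV !mxE.
Qed.

(** An isomorphism with a sum of interval modules amounts to vectors [e j a]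
that are zero off the bar [j], are carried to each other by the transitions,
and form at each point [a] a basis when restricted to the bars alive at [a]. *)
Section BarBasis.
Variables (k : fieldType) (R : realType).

Definition bar_family (X : pmod k R) (J : finType) (bar : J -> dgm R)
    (e : J -> forall a, X a) :=
  (forall j a, ~~ mem_dgm (bar j) a -> e j a = 0) /\
  (forall j a b, a <= b -> mem_dgm (bar j) a -> transition X a b (e j a) = e j b).

Definition bar_span (X : pmod k R) (J : finType) (e : J -> forall a, X a) :=
  forall a (v : X a), exists c : J -> k, v = \sum_j c j *: e j a.

Definition bar_free (X : pmod k R) (J : finType) (bar : J -> dgm R)
    (e : J -> forall a, X a) :=
  forall a (c : J -> k), \sum_j c j *: e j a = 0 ->
  forall j, mem_dgm (bar j) a -> c j = 0.

Definition bar_basis (X : pmod k R) (J : finType) (bar : J -> dgm R) e :=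
  [/\ @bar_family X J bar e, @bar_span X J e & @bar_free X J bar e].

Lemma bar_basis_iso (X Y : pmod k R) (J : finType) (bar : J -> dgm R) e :
  pmod_iso X Y -> @bar_basis X J bar e -> exists e', @bar_basis Y J bar e'.
Proof.
move=> [f [g [fK gK]]] [[e0 etr] espan efree]; exists (fun j a => f a (e j a)).
split; [split=> [j a /e0 ->|j a b ab ja]|move=> a v|move=> a c].
- exact: linear0.
- by rewrite -transition_nat // etr.
- have [c gv] := espan a (g a v); exists c; rewrite -[v]gK gv linear_sum.
  by apply: eq_bigr => j _; rewrite linearZ.
- move=> c0; apply: efree; apply: (can_inj (fK a)).
  by rewrite linear0 linear_sum -[RHS]c0; apply: eq_bigr => j _; rewrite linearZ.
Qed.

Lemma bar_free_sub (X : pmod k R) (J K : finType) (bar : J -> dgm R) e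
    (h : K -> J) : injective h ->
  @bar_free X J bar e -> @bar_free X K (bar \o h) (e \o h).
Proof.
move=> hinj efree a c c0 i /= ia.
have <- : \sum_(i' | h i' == h i) c i' = c i.
  by rewrite (big_pred1 i) // => i'; rewrite /= (inj_eq hinj).
apply: (efree a (fun j => \sum_(i' | h i' == j) c i') _ (h i) ia).
rewrite -{}[RHS]c0 [RHS](partition_big h xpredT) //=; apply: eq_bigr => j _.
by rewrite scaler_suml; apply: eq_bigr => i' /eqP ->.
Qed.

Lemma const_row_sum (m : bool) (u : 'rV[k]_m) : const_mx (row_sum u) = u.
Proof.
case: m u => u; apply/rowP => i; last by case: i.
by rewrite mxE /row_sum big_ord1 (ord1 i).
Qed.

Lemma const_mulmx (m m' : bool) : m ->
  (const_mx 1 : 'rV[k]_m) *m (const_mx 1 : 'M_(m, m')) = const_mx 1.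
Proof.
by case: m => // _; apply/rowP => i; rewrite !mxE big_ord1 !mxE mulr1.
Qed.

Lemma sum_pair0 (V W : vectType k) (J : finType) (F : J -> W) :
  \sum_j ((0, F j) : V * W) = (0, \sum_j F j).
Proof. by elim/big_rec2: _ => // j u v _ ->; congr (_, _); rewrite addr0. Qed.

Lemma sum_of_bars_basis (B : seq (dgm R)) :
  exists e, @bar_basis (sum_of_bars k B) 'I_(size B) (tnth (in_tuple B)) e.
Proof.
elim: B => [|I B [e [[e0 etr] espan efree]]].
  exists (fun _ _ => 0); split; [split=> -[]//| |by move=> a c _ []].
  by move=> a v; exists (fun=> 0); rewrite [v]thinmx0 big_ord0.
pose e1 (j : 'I_(size (I :: B))) a : sum_of_bars k (I :: B) a :=
  if unlift ord0 j is Some i then (0, e i a) else (const_mx 1, 0).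
have e1_0 a : e1 ord0 a = (const_mx 1, 0) by rewrite /e1 unlift_none.
have e1_S j a : e1 (lift ord0 j) a = (0, e j a) by rewrite /e1 liftK.
have tnS j : tnth (in_tuple (I :: B)) (lift ord0 j) = tnth (in_tuple B) j.
  by rewrite !(tnth_nth I).
have sum1 a (c : 'I_(size (I :: B)) -> k) : \sum_j c j *: e1 j a =
    (const_mx (c ord0), \sum_j c (lift ord0 j) *: e j a).
  rewrite big_ord_recl e1_0 (eq_bigr (fun j => (0, c (lift ord0 j) *: e j a))).
    rewrite sum_pair0; congr (_, _); last by rewrite /= scaler0 add0r.
    by apply/rowP => i; rewrite !mxE mulr1 addr0.
  by move=> j _; rewrite e1_S; congr (_, _); rewrite scaler0.
exists e1; split; [split|..].
- move=> j a; case: (unliftP ord0 j) => [i|] ->.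
    by rewrite tnS e1_S => /e0 ->.
  rewrite (tnth_nth I) /= e1_0 => na; congr (_, _).
  by apply: row_sum_eq0; exact: row_sum_false.
- move=> j a b ab; rewrite transitionE; case: (unliftP ord0 j) => [i|] ->.
    rewrite tnS !e1_S => /(etr i a b ab); rewrite transitionE => ei.
    by rewrite lfunE /= /pair_map /= linear0 ei.
  rewrite (tnth_nth I) /= !e1_0 => ma; rewrite lfunE /= /pair_map /= linear0.
  congr (_, _); rewrite lfunE /=; exact: const_mulmx.
- move=> a [u v]; have [c vc] := espan a v.
  exists (fun j => if unlift ord0 j is Some i then c i else row_sum u).
  rewrite sum1 unlift_none vc; congr (_, _).
    by rewrite const_row_sum.
  by apply: eq_bigr => j _; rewrite liftK.
- move=> a c; rewrite sum1 => -[c0 cS] j; case: (unliftP ord0 j) => [i|] ->.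
    by rewrite tnS; apply: (efree a (fun j => c (lift ord0 j))).
  rewrite (tnth_nth I) /= => ma.
  by rewrite -(row_sum_true (c ord0) ma) c0 /row_sum big1 // => i _; rewrite mxE.
Qed.

Lemma barcode_basis (X : pmod k R) (B : seq (dgm R)) : is_barcode X B ->
  exists e, @bar_basis X 'I_(size B) (tnth (in_tuple B)) e.
Proof.
move=> XB; have [e eB] := sum_of_bars_basis B.
by apply: bar_basis_iso eB; apply: pmod_iso_sym.
Qed.

End BarBasis.

(** Tracks where the entries kept by [pmap] come from, as an injection on
indices; the default values [x0] and [y0] are never reached. *)
Lemma pmap_select (T U : Type) (f : T -> option U) (x0 : T) (y0 : U) (s : seq T) :
  exists h : nat -> nat, forall i, (i < size (pmap f s))%N ->
    [/\ (h i < size s)%N, f (nth x0 s (h i)) = Some (nth y0 (pmap f s) i)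
      & forall j, (j < size (pmap f s))%N -> h i = h j -> i = j].
Proof.
elim: s => [|x s [h hP]]; first by exists id.
rewrite /=; case fx : (f x) => [y|] /=; last first.
  exists (fun i => (h i).+1) => i /hP[hi fi inj]; split=> // j /inj ij [].
  exact: ij.
exists (fun i => if i is i'.+1 then (h i').+1 else 0%N) => -[_|i /hP[hi fi inj]].
  by split=> // -[].
by split=> // -[//|j] /inj ij [/ij ->].
Qed.

Section Matching.
Variables (k : fieldType) (R : realType).

Lemma birth_lt_death (I : dgm R) : ((birth I)%:E < death I)%E.
Proof. by case: I. Qed.

Lemma arg_max_support n (v : 'I_n -> k) (q : 'I_n -> \bar R) (i0 : 'I_n) :
  v i0 != 0 -> exists2 i, v i != 0 & forall i', v i' != 0 -> (q i' <= q i)%E.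
Proof.
move=> v0; case: (@arg_maxP _ _ _ i0 (fun i => v i != 0) q v0) => i vi imax.
by exists i => // i' vi'; exact: imax.
Qed.

(** The assumptions say that the image of X(a) -> X(a + eps) is a subquotient of
Y: inside Z it lies in the image of Y(a + eps). *)
Variables (X Y Z : pmod k R) (incl : pmor X Z) (g : pmor Y Z) (eps : R).
Hypothesis eps_ge0 : 0 <= eps.
Hypothesis incl_inj : forall a, injective (incl a).
Hypothesis image_shift : forall a (x : X a), exists y : Y (a + eps),
  g (a + eps) y = incl (a + eps) (transition X a (a + eps) x).

(** The start of each bar of X that outlives [eps] becomes, at its birth shifted
by [eps], the image of a combination of bars of Y.  That only bars of Y living
long enough are needed is seen on a whole linear relation at once, at its
longest-lived member, and not bar by bar. *)
Lemma bar_matching n m (barX : 'I_n -> dgm R) (barY : 'I_m -> dgm R)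
    (ex : 'I_n -> forall a, X a) (ey : 'I_m -> forall a, Y a) :
  bar_family barX ex -> bar_free barX ex ->
  bar_family barY ey -> bar_span ey ->
  (forall i, ((birth (barX i) + eps)%:E < death (barX i))%E) ->
  exists2 f : 'I_n -> 'I_m, injective f & forall i,
    mem_dgm (barY (f i)) (birth (barX i) + eps) /\
    (death (barX i) <= death (barY (f i)))%E.
Proof.
move=> [ex0 extr] exfree [ey0 eytr] eyspan long.
pose p i := birth (barX i); pose q i := death (barX i).
have pX i : mem_dgm (barX i) (p i).
  rewrite /mem_dgm lexx /=; apply: le_lt_trans (long i).
  by rewrite lee_fin lerDl.
have /choice[c cP] : forall i, exists c : 'I_m -> k,
    g (p i + eps) (\sum_j c j *: ey j (p i + eps)) =
    incl (p i + eps) (transition X (p i) (p i + eps) (ex i (p i))).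
  move=> i; have [y <-] := image_shift (ex i (p i)).
  by have [c ->] := eyspan _ y; exists c.
(* Only the coefficients of bars of Y that contain the eroded bar of X count. *)
pose A := \matrix_(i, j) if mem_dgm (barY j) (p i + eps) &&
  (q i <= death (barY j))%E then c i j else 0.
have [f finj fA] : exists2 f : 'I_n -> 'I_m,
    injective f & forall i, A i (f i) != 0; last first.
  exists f => // i; move: (fA i); rewrite mxE.
  by case: ifP => [/andP[]//|_]; rewrite eqxx.
apply: row_free_matching; apply: inj_row_free => v vA0.
apply/rowP => i0; rewrite [RHS]mxE; apply/eqP/negPn/negP => vi0.
(* In a relation between the rows, the bar i1 dies last; at the point x, just
   below its death, all bars that die earlier are already zero. *)
have [i1 vi1 imax] := @arg_max_support n (v 0) q i0 vi0.
have [x [p1x xq1 px dx]] : exists x, [/\ p i1 + eps <= x, (x%:E < q i1)%E,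
    forall i, ((p i + eps)%:E < q i1)%E -> p i + eps <= x &
    forall j, (death (barY j) < q i1)%E -> (death (barY j) <= x%:E)%E].
  (* An infinite death contributes the value 0 to s, which does no harm. *)
  pose s := [seq p i + eps | i <- enum 'I_n] ++
    [seq fine (death (barY j)) | j <- enum 'I_m].
  have ps i : p i + eps \in s.
    by rewrite mem_cat; apply/orP; left; apply/map_f/mem_enum.
  have ds j : fine (death (barY j)) \in s.
    by rewrite mem_cat; apply/orP; right; apply/map_f/mem_enum.
  have [/(_ _ (ps i1))/negP[]|[x [_ xq1 xmax]]] := seq_max s (fun r => (r%:E < q i1)%E).
    exact: long.
  exists x; split=> // [|i iq|j]; first by apply: xmax => //; exact: long.
    exact: xmax.
  have := birth_lt_death (barY j); move: (xmax _ (ds j)).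
  case: (death (barY j)) => [d| |] dmax _ dq; last exact: leNye.
    by rewrite lee_fin; apply: dmax.
  by have := lt_le_trans dq (leey _); rewrite ltxx.
(* A coefficient dropped from A belongs to a bar that is zero at x. *)
have termE i j : v 0 i != 0 ->
    c i j *: transition Y (p i + eps) x (ey j (p i + eps)) = A i j *: ey j x.
  move=> /imax qi; rewrite mxE.
  have pix : p i + eps <= x by apply: px; apply: lt_le_trans (long i) qi.
  have [mj|mj] := boolP (mem_dgm (barY j) (p i + eps)); last first.
    by rewrite ey0 //= linear0 scaler0 scale0r.
  rewrite eytr //=; case: ifPn => //; rewrite -ltNge => dj.
  have /dx xd := lt_le_trans dj qi.
  by rewrite ey0 ?scaler0 // /mem_dgm negb_and -leNgt xd orbT.
have inclE i : v 0 i != 0 ->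
    incl x (ex i x) = g x (\sum_j A i j *: ey j x).
  move=> vi; have pix : p i + eps <= x.
    by apply: px; apply: lt_le_trans (long i) (imax i vi).
  have pp : p i <= p i + eps by rewrite lerDl.
  rewrite -(extr i _ _ (le_trans pp pix) (pX i)) -(transition_comp _ pp pix).
  rewrite transition_nat // -cP -transition_nat // linear_sum.
  by congr (g x _); apply: eq_bigr => j _; rewrite linearZ -termE.
have comb0 : \sum_i v 0 i *: ex i x = 0.
  apply: (incl_inj (a := x)); rewrite linear0 linear_sum.
  rewrite (eq_bigr (fun i => g x (v 0 i *: \sum_j A i j *: ey j x))); last first.
    move=> i _; have [->|vi] := eqVneq (v 0 i) 0; first by rewrite !scale0r !linear0.
    by rewrite !linearZ /= inclE.
  rewrite -linear_sum /= (eq_bigr (fun i => \sum_j (v 0 i * A i j) *: ey j x)).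
    rewrite exchange_big big1 ?linear0 // => j _; rewrite -scaler_suml.
    have := congr1 (fun u : 'rV_m => u 0 j) vA0; rewrite !mxE => ->.
    by rewrite scale0r.
  by move=> i _; rewrite scaler_sumr; apply: eq_bigr => j _; rewrite scalerA.
move: vi1; rewrite (exfree x (v 0) comb0 i1) ?eqxx // /mem_dgm xq1 andbT.
by apply: le_trans p1x; rewrite lerDl.
Qed.

Lemma preceq_of_subquotient (S T : seq R) : tame S X -> tame T Y -> preceq eps X Y.
Proof.
move=> /barc_is_barcode/barcode_basis[ex [famX _ freeX]].
move=> /barc_is_barcode/barcode_basis[ey [famY spanY _]].
rewrite /preceq; set A := barc_eps eps X; set B := barc Y in ey famY spanY *.
have [E|[I0 _]] : size A = 0%N \/ exists I0 : dgm R, True.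
- by case: (A) => [|I0 s]; [left|right; exists I0].
- have A0 (j : 'I_(size A)) : False by case: j => j; rewrite E.
  by exists (fun j => False_rect _ (A0 j)) => j; case: (A0 j).
have [h hP] := pmap_select
  (fun I : dgm R => insub (birth I + eps, death I) : option (dgm R)) I0 I0 (barc X).
rewrite -/(barc_eps eps X) -/A in hP.
have hlt (i : 'I_(size A)) : (h i < size (barc X))%N by case: (hP i (ltn_ord i)).
pose h' (i : 'I_(size A)) := Ordinal (hlt i).
have h'inj : injective h'.
  move=> i j [] /=; case: (hP i (ltn_ord i)) => _ _ inj.
  by move=> /(inj _ (ltn_ord j)) ij; apply: val_inj.
have hA i : bounds (tnth (in_tuple A) i) =
    (birth (tnth (in_tuple (barc X)) (h' i)) + eps,
     death (tnth (in_tuple (barc X)) (h' i))).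
  case: (hP i (ltn_ord i)) => _ + _; rewrite !(tnth_nth I0) /=.
  by case: insubP => // u _ <- [->].
have famX' : bar_family (tnth (in_tuple (barc X)) \o h') (ex \o h').
  by split=> [i a|i a b]; [apply: famX.1 | apply: famX.2].
have birthA i : birth (tnth (in_tuple A) i) =
    birth (tnth (in_tuple (barc X)) (h' i)) + eps by rewrite /birth hA.
have deathA i : death (tnth (in_tuple A) i) =
    death (tnth (in_tuple (barc X)) (h' i)) by rewrite /death hA.
have [|f finj fP] := bar_matching famX' (bar_free_sub h'inj freeX) famY spanY.
  by move=> i; rewrite /= -birthA -deathA birth_lt_death.
exists f => // i x; rewrite /set_of_dgm /= /mem_dgm birthA deathA.
move=> /andP[bx xd]; have [/andP[bY _] dY] := fP i.
by rewrite (le_trans bY bx) (lt_le_trans xd dY).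
Qed.

End Matching.

(** * Images and reindexing *)

Lemma lfun_bijective (k : fieldType) (V W : vectType k) (f : 'Hom(V, W)) :
  injective f -> (forall w, exists v, f v = w) -> bijective f.
Proof.
move=> finj fsurj; have f0 : lker f == 0%VS by apply/lker0P.
exists (f^-1)%VF => [v|w]; first exact: lker0_lfunK.
by have [v <-] := fsurj w; rewrite lker0_lfunK.
Qed.

Section Functoriality.
Variables (k : fieldType) (d d' : Order.disp_t).
Variables (P : porderType d) (Q : porderType d').

Lemma transition_reindex (h : Q -> P) (hm : {homo h : x y / (x <= y)%O})
    (M : pmod k P) x y v : (x <= y)%O ->
  transition (Defs.reindex hm M) x y v = transition M (h x) (h y) v.
Proof. by move=> xy; rewrite transitionE (transitionE _ (hm _ _ xy)). Qed.

Definition reindex_mor (h : Q -> P) (hm : {homo h : x y / (x <= y)%O})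
  (M N : pmod k P) (f : pmor M N) : pmor (Defs.reindex hm M) (Defs.reindex hm N).
Proof. by exists (fun x => f (h x)) => x y xy; exact: (pmor_nat f (hm x y xy)). Defined.

Lemma reindex_iso (h : Q -> P) (hm : {homo h : x y / (x <= y)%O})
  (M N : pmod k P) : pmod_iso M N -> pmod_iso (Defs.reindex hm M) (Defs.reindex hm N).
Proof.
move=> [f [g [fK gK]]]; exists (reindex_mor hm f), (reindex_mor hm g).
by split=> x; [exact: fK|exact: gK].
Qed.

Section Image.
Variables (M N : pmod k P) (f : pmor M N).

Lemma im_mor p q (pq : (p <= q)%O) (u : im f p) :
  vsval (mor (im f) pq u) = mor N pq (vsval u).
Proof.
rewrite !comp_lfunE !lfunE /= vsprojK //.
have /memv_imgP[v _ ->] := subvsP u.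
by rewrite -[mor N pq _]comp_lfunE -pmor_nat comp_lfunE; apply/memv_img/memvf.
Qed.

Lemma im_transition p q (u : im f p) : (p <= q)%O ->
  vsval (transition (im f) p q u) = transition N p q (vsval u).
Proof. by move=> pq; rewrite !transitionE im_mor. Qed.

Definition im_incl : pmor (im f) N.
Proof.
exists (fun p => linfun (vsval : subvs_of (limg (f p)) -> N p)) => p q pq.
by apply/lfunP => u; rewrite comp_lfunE [RHS]comp_lfunE [LHS]lfunE
  [X in _ = mor N pq X]lfunE; exact: im_mor.
Defined.

Lemma im_inclE p u : im_incl p u = vsval u.
Proof. by rewrite lfunE. Qed.

Lemma im_incl_inj p : injective (im_incl p).
Proof. by move=> u v; rewrite !im_inclE; exact: subvs_inj. Qed.

Lemma im_mem p v : f p v \in limg (f p).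
Proof. by rewrite memv_img ?memvf. Qed.

Lemma im_lift p (u : im f p) : exists v, vsval u = f p v.
Proof. by have /memv_imgP[v _ ->] := subvsP u; exists v. Qed.

End Image.

Lemma im_comp_iso (L M N : pmod k P) (f : pmor L M) (h : pmor M N) (f' : pmor L N) :
  (forall p, injective (h p)) -> (forall p u, f' p u = h p (f p u)) ->
  pmod_iso (im f) (im f').
Proof.
move=> hinj f'E.
have hmem p (u : im f p) : h p (vsval u) \in limg (f' p).
  by have [v ->] := im_lift u; rewrite -f'E im_mem.
pose c p : 'Hom(im f p, im f' p) :=
  (linfun (vsproj (limg (f' p))) \o h p \o im_incl f p)%VF.
have cE p u : vsval (c p u) = h p (vsval u).
  by rewrite !comp_lfunE im_inclE lfunE /= vsprojK; last exact: hmem.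
have natE p q (pq : (p <= q)%O) u :
    c q (mor (im f) pq u) = mor (im f') pq (c p u).
  apply: subvs_inj; rewrite cE !im_mor cE.
  by rewrite -[LHS]comp_lfunE pmor_nat comp_lfunE.
have nat p q (pq : (p <= q)%O) : (c q \o mor (im f) pq = mor (im f') pq \o c p)%VF.
  by apply/lfunP => u; rewrite comp_lfunE [RHS]comp_lfunE natE.
apply: (@iso_of_bijective _ _ _ _ _ (PMor nat)) => p /=.
  by move=> u v /(congr1 vsval); rewrite !cE => /hinj /subvs_inj.
move=> v; have [w vw] := im_lift v; exists (vsproj (limg (f p)) (f p w)).
by apply: subvs_inj; rewrite cE vsprojK ?im_mem // vw f'E.
Qed.

End Functoriality.

Section Tame.
Variables (k : fieldType) (R : realType).

Lemma im_tame S (X Y : pmod k R) (f : pmor X Y) :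
  tame S X -> tame S Y -> tame S (im f).
Proof.
move=> tX tY; split=> [x Sx u|x y xy fxy].
  by apply: subvs_inj; rewrite [LHS](tY.1 x Sx) [RHS](tY.1 x Sx).
apply: lfun_bijective => [u v /(congr1 vsval)|v].
  by rewrite !im_transition // => /(tame_inj tY xy fxy)/subvs_inj.
have [w vw] := im_lift v; have [h _ hK] := tX.2 x y xy fxy.
exists (vsproj (limg (f x)) (f x (h w))); apply: subvs_inj.
rewrite im_transition // vsprojK ?im_mem //.
by rewrite -transition_nat // hK vw.
Qed.

Lemma shift_tame S e (X : pmod k R) :
  tame S X -> tame [seq r - e | r <- S] (shift e X).
Proof.
move=> [X0 Xb]; split=> [x Sx|x y xy fxy].
  by apply: X0 => r rS; rewrite -ltrBrDr; apply: Sx; apply/mapP; exists r.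
have -> : transition (shift e X) x y = transition X (x + e) (y + e).
  by apply/lfunP => v; rewrite transition_reindex.
apply: Xb; first by rewrite lerD2r.
move=> r rS xr; rewrite -ltrBrDr; apply: fxy; last by rewrite ltrBrDr.
by apply/mapP; exists r.
Qed.

End Tame.

(** * Meta-ranks of constructible bimodules *)

Section Knots.
Variables (k : fieldType) (R : realType).

Lemma in_cell_last (S : seq R) r x : sorted <%R S ->
  r \in S -> r <= x -> knot_free S r x -> in_cell S (index r S) x.
Proof.
move=> sS rS rx frx; have iS : (index r S < size S)%N by rewrite index_mem.
rewrite /in_cell /knot (nth_map 0) // nth_index // lee_fin rx /=.
have [i1|i1] := ltnP (index r S).+1 (size S); last first.
  by rewrite nth_default ?size_map ?ltry.
rewrite (nth_map 0) // lte_fin; apply: frx; first exact: mem_nth.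
rewrite -{1}(nth_index 0 rS).
by apply: (sorted_ltn_nth lt_trans) => //; rewrite inE.
Qed.

Lemma cell_exists (S : seq R) x y : sorted <%R S -> S != [::] ->
  head 0 S <= x -> x <= y -> knot_free S x y ->
  exists i, [/\ (i < size S)%N, in_cell S i x & in_cell S i y].
Proof.
move=> sS S0 hx xy fxy; have [before|[r [rS rx frx]]] := last_knot S x.
  have /before : head 0 S \in S by case: (S) S0 => //= *; rewrite mem_head.
  by rewrite ltNge hx.
exists (index r S); rewrite index_mem; split=> //.
  exact: in_cell_last.
apply: in_cell_last => //; first exact: le_trans xy.
by move=> r' r'S /(frx _ r'S); exact: fxy.
Qed.

Variables (S : seq R) (M : bimod k R).
Hypothesis hM : constructible S M.

Lemma constructible_zero (p : (R *p R)%type) (v : M p) :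
  p.1 < head 0 S \/ p.2 < head 0 S -> v = 0.
Proof.
case: hM => _ _ M0 _ /M0 /eqP; rewrite dimv_eq0 => /eqP M00.
by apply/eqP; rewrite -memv0 -M00 memvf.
Qed.

Lemma constructible_bij (p q : (R *p R)%type) : (p <= q)%O ->
  knot_free S p.1 q.1 -> knot_free S p.2 q.2 -> bijective (transition M p q).
Proof.
case: (hM) => sS S0 _ Mb pq f1 f2; have := pq.
rewrite Order.ProdOrder.leEprod => /andP[pq1 pq2].
have hS : head 0 S \in S by case: (S) S0 => //= *; rewrite mem_head.
have zero : p.1 < head 0 S \/ p.2 < head 0 S -> bijective (transition M p q).
  move=> ph; have qh : q.1 < head 0 S \/ q.2 < head 0 S.
    by case: ph => ph; [left; exact: f1|right; exact: f2].
  apply: lfun_bijective => [u v _|v].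
    by rewrite (constructible_zero u ph) (constructible_zero v ph).
  by exists 0; rewrite linear0 (constructible_zero v qh).
have [/or_introl/zero//|p1] := ltP p.1 (head 0 S).
have [/or_intror/zero//|p2] := ltP p.2 (head 0 S).
have [i [iS ip iq]] := cell_exists sS S0 p1 pq1 f1.
have [j [jS jp jq]] := cell_exists sS S0 p2 pq2 f2.
by rewrite transitionE; exact: Mb iS jS _ _ _ _.
Qed.

Lemma slice_tame s : tame S (slice M s).
Proof.
case: (hM) => _ S0 _ _; split=> [x Sx v|x y xy fxy].
  apply: (constructible_zero v); right; apply: Sx.
  by case: (S) S0 => //= *; rewrite mem_head.
have -> : transition (slice M s) x y = transition M (s, x) (s, y).
  by apply/lfunP => v; rewrite transition_reindex.
by apply: constructible_bij => //=; exact: vline_homo.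
Qed.

Lemma phi_xE s t (st : s <= t) a v :
  phi_x M st a v = transition M (s, a) (t, a) v.
Proof. by rewrite (transitionE _ (hline_homo a st)). Qed.

(** A transition without knots is injective on every row, hence identifies the
two images. *)
Lemma im_phi_x_iso s w u (sw : s <= w) (su : s <= u) :
  w <= u -> knot_free S w u -> pmod_iso (im (phi_x M sw)) (im (phi_x M su)).
Proof.
move=> wu fwu; apply: (@im_comp_iso _ _ _ _ _ _ _ (phi_x M wu)).
  move=> a; have -> : phi_x M wu a = transition M (w, a) (u, a).
    by apply/lfunP => v; rewrite phi_xE.
  by apply/bij_inj/constructible_bij => //=; exact: hline_homo.
by move=> a v; rewrite !phi_xE transition_comp //; exact: hline_homo.
Qed.

(** Whether or not the right end of [I] is a knot, the meta-rank is computed at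
a point that no knot separates from the points just below that end. *)
Lemma mrk_end_near (I : dgm R) : exists w0,
  (w0%:E < death I)%E /\ forall w, w0 <= w -> (w%:E < death I)%E ->
    (w <= mrk_end S I /\ knot_free S w (mrk_end S I)) \/
    (mrk_end S I <= w /\ knot_free S (mrk_end S I) w).
Proof.
case: (hM) => sS S0 _ _; have := birth_lt_death I.
rewrite /mrk_end; set s := birth I; case: (death I) => [t| |]; last by [].
- rewrite lte_fin => st; case: ifPn => [tS|tS].
  + set u := Num.max _ _; exists u.
    have iS : (index t S < size S)%N by rewrite index_mem.
    have ut : u < t.
      rewrite gt_max st /=; case E : (index t S) => [//|i] /=.
      rewrite -(nth_index s tS) E.
      by apply: (sorted_ltn_nth lt_trans) => //; rewrite inE -?E // ltnW // -E.
    split=> [|w uw]; rewrite ?lte_fin // => wt; right; split=> // r rS.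
    rewrite gt_max => /andP[_ ir]; rewrite ltNge; apply/negP => /le_lt_trans/(_ wt).
    have jS : (index r S < size S)%N by rewrite index_mem.
    rewrite -{1}(nth_index s rS) -(nth_index s tS).
    rewrite (lt_sorted_ltn_nth s sS) ?inE // => ji; move: ir.
    case: (index t S) iS ji => [//|i] iS ji; rewrite /= -{1}(nth_index s rS).
    by rewrite (lt_sorted_ltn_nth s sS) ?inE ?(ltnW iS) // ltnNge -ltnS ji.
  + have [no|[w0 [w0S w0t w0max]]] := seq_max S (fun r => r < t).
      exists s; split=> // w sw; rewrite lte_fin => wt; left; split; first exact: ltW.
      move=> r rS _; have := no r rS; rewrite -leNgt le_eqVlt.
      by case/predU1P => // rt; rewrite -rt (negPf tS) in rS.
    exists w0; split=> // w w0w; rewrite lte_fin => wt; left; split; first exact: ltW.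
    move=> r rS wr; rewrite lt_neqAle; apply/andP; split.
      by apply: contraNneq tS => ->.
    by rewrite leNgt; apply/negP => /(w0max _ rS); rewrite leNgt (le_lt_trans w0w wr).
- move=> _; exists (Num.max s (last s S)); split; first exact: ltry.
  move=> w uw _; right; split=> // r rS; rewrite gt_max => /andP[_].
  rewrite ltNge => /negP[]; have jS : (index r S < size S)%N by rewrite index_mem.
  rewrite -{1}(nth_index s rS) -nth_last (lt_sorted_leq_nth s sS) ?inE //.
    by rewrite -ltnS (leq_trans jS) // leqSpred.
  by case: (S) S0.
Qed.

Lemma mrk_iso_near (I : dgm R) : exists w0,
  (w0%:E < death I)%E /\ forall w (sw : birth I <= w), w0 <= w -> (w%:E < death I)%E ->
    pmod_iso (mrk S M I) (im (phi_x M sw)).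
Proof.
have [w0 [w0t w0P]] := mrk_end_near I; exists w0; split=> // w sw w0w wt.
have [[wu fwu]|[uw fuw]] := w0P w w0w wt; last exact: im_phi_x_iso.
by apply: pmod_iso_sym; exact: im_phi_x_iso.
Qed.

End Knots.

(** * Interleavings and erosion *)

Section Interleaving.
Variables (k : fieldType) (R : realType) (e : {nonneg R}) (M N : bimod k R).
Notation pt := (R *p R)%type.

(** An interleaving map followed by a transition: with a target free to be any
sufficiently large point, the scale [e] may be replaced by any larger one. *)
Definition lift_map (f : pmor M (shift2 e%:num N)) (p q : pt) : 'Hom(M p, N q) :=
  (transition N (dshift e%:num p) q \o (f p : 'Hom(M p, N (dshift e%:num p))))%VF.

Lemma lift_mapE f p q v :
  lift_map f p q v = transition N (dshift e%:num p) q (f p v).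
Proof. by rewrite comp_lfunE. Qed.

Lemma lift_map_post f p q q' v : (dshift e%:num p <= q)%O -> (q <= q')%O ->
  transition N q q' (lift_map f p q v) = lift_map f p q' v.
Proof. by move=> pq qq'; rewrite !lift_mapE transition_comp. Qed.

Lemma lift_map_pre f p p' q v : (p <= p')%O -> (dshift e%:num p' <= q)%O ->
  lift_map f p' q (transition M p p' v) = lift_map f p q v.
Proof.
move=> pp' pq; rewrite !lift_mapE transition_nat // transition_reindex //.
by rewrite transition_comp //; exact: dshift_homo.
Qed.

End Interleaving.

Lemma interleaved_sym (k : fieldType) (R : realType) (e : {nonneg R})
  (M N : bimod k R) : interleaved e M N -> interleaved e N M.
Proof. by move=> [f [g [gf fg]]]; exists g, f. Qed.

Lemma lift_map_comp (k : fieldType) (R : realType) (e : {nonneg R})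
    (M N : bimod k R) (f : pmor M (shift2 e%:num N))
    (g : pmor N (shift2 e%:num M)) p q r v :
  (forall p, (g (dshift e%:num p) \o f p)%VF = mor M (dshift2_le e p)) ->
  (dshift e%:num p <= q)%O -> (dshift e%:num q <= r)%O ->
  lift_map g q r (lift_map f p q v) = transition M p r v.
Proof.
move=> gf pq qr; rewrite [lift_map f p q v]lift_mapE lift_map_pre // lift_mapE.
rewrite -[g _ _]comp_lfunE gf -transitionE transition_comp //; first exact: dshift2_le.
by apply: le_trans qr; exact: dshift_homo.
Qed.

Section Erosion.
Variables (k : fieldType) (R : realType) (e : {nonneg R}) (eps : {posnum R}).
Hypothesis e_eps : e%:num <= eps%:num.

(** The maps N -> M give the morphism [G] from the meta-rank of N to the ambient
slice of M.  The maps M -> N do not descend to the meta-rank of M, which is an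
image, so they are applied to a lift of each of its elements; this is why only
a subquotient relation, and not an interleaving, is available. *)
Lemma erosion_le_mrk (M N : bimod k R) (S T : seq R) :
  constructible S M -> constructible T N -> interleaved e M N ->
  erosion_le eps (mrk S M) (mrk T N).
Proof.
move=> hM hN [f [g [gf _]]] I; set s := birth I.
have [w1 [w1t w1P]] := mrk_iso_near hM (Defs.expand eps I).
have [w2 [w2t w2P]] := mrk_iso_near hN I.
(* One w serves both bimodules, with target w for N and w + eps for M. *)
have [w [sw w2w w1w wt]] : exists w, [/\ s <= w, w2 <= w, w1 <= w + eps%:num &
    (w%:E < death I)%E].
  exists (Num.max s (Num.max w2 (w1 - eps%:num))).
  rewrite !le_max lexx /= -!lerBlDr !le_max !lexx !orbT; split=> //.
  by rewrite !EFin_max !gt_max birth_lt_death w2t EFinB lteBlDr.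
have swe : birth (Defs.expand eps I) <= w + eps%:num.
  by rewrite /birth /= lerBlDr -addrA; apply: le_trans sw _; rewrite lerDl addr_ge0.
have wet : ((w + eps%:num)%:E < death (Defs.expand eps I))%E.
  by rewrite EFinD -lteBlDr // [X in (_ < X)%E]/death /=  addeK.
have isoM := w1P (w + eps%:num) swe w1w wet.
have isoN := w2P w sw w2w wt.
rewrite /preceq /barc_eps (barc_iso isoN).
rewrite (barc_iso (reindex_iso (addr_homo eps%:num) isoM)).
pose ph : pmor _ _ := phi_x M swe; pose ps : pmor _ _ := phi_x N sw.
have ge a : (dshift e%:num (w, a) <= (w + eps%:num, a + eps%:num))%O.
  by rewrite Order.ProdOrder.leEprod /= !lerD2l e_eps.
have pge a : (dshift e%:num (s - eps%:num, a + eps%:num) <= (s, a + 2 * eps%:num))%O.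
  rewrite Order.ProdOrder.leEprod /= -addrA gerDl addrC subr_le0 e_eps /=.
  by rewrite -addrA lerD2l mulr2n mulrDl mul1r lerD2l.
pose G a : 'Hom(im ps a, shift eps%:num (slice M (w + eps%:num)) a) :=
  (lift_map g (w, a) (w + eps%:num, a + eps%:num) \o im_incl ps a)%VF.
have GE a u : G a u = lift_map g (w, a) (w + eps%:num, a + eps%:num) (vsval u).
  by rewrite comp_lfunE im_inclE.
have Gnat a b (ab : (a <= b)%O) :
    (G b \o mor (im ps) ab =
     mor (shift eps%:num (slice M (w + eps%:num))) ab \o G a)%VF.
  apply/lfunP => u; rewrite comp_lfunE [RHS]comp_lfunE !GE im_mor -!transitionE.
  rewrite !transition_reindex ?lerD2r // lift_map_post //; last first.
    by apply: vline_homo; rewrite lerD2r.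
  by rewrite lift_map_pre //; exact: vline_homo.
apply: (@preceq_of_subquotient k R _ _ _
  (reindex_mor (addr_homo eps%:num) (im_incl ph)) (PMor Gnat)).
- by rewrite mulr_ge0.
- by move=> a; exact: im_incl_inj.
- move=> a x; have [m xm] := im_lift (x : im ph (a + eps%:num)).
  pose p := (s - eps%:num, a + eps%:num) : (R *p R)%type.
  pose a' := a + 2 * eps%:num.
  pose y : N (w, a') := lift_map f p (w, a') m.
  have yE : y = ps a' (lift_map f p (s, a') m).
    rewrite phi_xE lift_map_post //; [exact: pge|exact: hline_homo].
  have yim : y \in limg (ps a') by rewrite yE; exact: im_mem.
  exists (vsproj (limg (ps a')) y).
  rewrite [LHS]GE vsprojK // (lift_map_comp _ gf) //; last first.
    by apply: le_trans (pge a) _; exact: hline_homo.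
  have aa' : a <= a' by rewrite lerDl mulr_ge0.
  have inclx : reindex_mor (addr_homo eps%:num) (im_incl ph) a x =
      transition M p (w + eps%:num, a + eps%:num) m.
    by rewrite -[LHS]/(im_incl ph _ x) im_inclE xm; exact: phi_xE.
  rewrite (transition_nat _ _ aa') inclx !transition_reindex ?lerD2r //.
  rewrite transition_comp //; first exact: hline_homo.
  exact: vline_homo (addr_homo eps%:num aa').
- apply: shift_tame; apply: im_tame; exact: slice_tame hM _.
- apply: im_tame; exact: slice_tame hN _.
Qed.

Lemma d_E_le (M N : bimod k R) (S T : seq R) :
  constructible S M -> constructible T N -> interleaved e M N ->
  (d_E (mrk S M) (mrk T N) <= eps%:num%:E)%E.
Proof.
move=> hM hN MN; apply: ereal_inf_lbound; exists eps => //.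
by split; apply: erosion_le_mrk => //; exact: interleaved_sym.
Qed.

End Erosion.

Theorem theorem17 (k : fieldType) (R : realType) (M N : bimod k R)
    (S T : seq R) (hM : constructible S M) (hN : constructible T N) :
  (d_E (mrk S M) (mrk T N) <= d_I M N)%E.
Proof.
(* A strictly larger scale is positive even when the interleaving scale is 0. *)
apply: le_ereal_inf_tmp => _ [e MN <-]; apply/lee_addgt0Pr => d d0.
have ed : 0 < e%:num + d by rewrite ltr_wpDl.
rewrite -EFinD -[e%:num + d]/((PosNum ed)%:num).
by apply: d_E_le hM hN MN; rewrite /= lerDl ltW.
Qed.
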